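(* Let $G$ be a finite group. Then: (1) $\mathcal I(G)$ is totally disconnected if and only if $G$ is isomorphic to one of $\mathbb Z_{p^2}$, $\mathbb Z_p\times\mathbb Z_p$, $\mathbb Z_{pq}$, $\mathbb Z_q\rtimes\mathbb Z_p$ for some distinct primes $p,q$; (2) $\mathcal I(G)$ is bipartite if and only if $|G|$ is one of $p^2$, $pq$, $p^3$, $p^2q$, $pqr$ for some distinct primes $p,q,r$.
   Context: For a finite group $G$, the inclusion graph of subgroups $\mathcal I(G)$ is the simple graph whose vertices are the proper subgroups of $G$, where ''proper'' means different from both the trivial subgroup and $G$ itself; two distinct vertices $H,K$ are adjacent if and only if $H\subset K$ or $K\subset H$. Graphs are understood to have a nonempty vertex set, so $G$ is assumed to have at least one subgroup different from $\{e\}$ and $G$. A graph is totally disconnected if it has no edges. A graph is bipartite if its vertex set can be partitioned into two (possibly empty) sets such that every edge joins a vertex of one to a vertex of the other. $\mathbb Z_q\rtimes\mathbb Z_p$ denotes the non-abelian semidirect product $\langle a,b\mid a^q=b^p=1,\ bab^{-1}=a^i,\ \mathrm{ord}_q(i)=p\rangle$, which exists when $p\mid (q-1)$; $\mathrm{ord}_q(i)$ is the multiplicative order of $i$ modulo $q$. *)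

(* Defs.v *)
From mathcomp Require Import all_boot all_order all_algebra all_fingroup all_solvable.

Set Implicit Arguments.
Unset Strict Implicit.
Unset Printing Implicit Defensive.

Record sgraph := SGraph {
  vertex :> finType;
  adj : rel vertex;
  adj_sym : symmetric adj;
  adj_irr : irreflexive adj }.

Definition totally_disconnected (X : sgraph) : Prop :=
  forall x y : X, ~~ adj x y.

Definition bipartite (X : sgraph) : Prop :=
  exists A B : {set X},
    [/\ A :|: B = [set: X], A :&: B = set0 &
        forall x y : X, adj x y ->
          (x \in A) && (y \in B) || (x \in B) && (y \in A)].

Section InclusionGraph.

Variables (gT : finGroupType) (G : {group gT}).

Local Open Scope group_scope.

Definition proper_nontrivial (H : {group gT}) : bool :=
  [&& H \subset G, H :!=: 1 & H :!=: G].

Definition proper_subgroup : finType :=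
  {H : {group gT} | proper_nontrivial H}.

Definition incl_adj : rel proper_subgroup := fun H K =>
  (H != K) && ((val H \subset val K) || (val K \subset val H)).

Lemma incl_adj_sym : symmetric incl_adj.
Proof. by move=> H K; rewrite /incl_adj eq_sym orbC. Qed.

Lemma incl_adj_irr : irreflexive incl_adj.
Proof. by move=> H; rewrite /incl_adj eqxx. Qed.

Definition inclusion_graph : sgraph := SGraph incl_adj_sym incl_adj_irr.

End InclusionGraph.

(* Primitivity of [i] as a [p]-th root of unity in the field ['F_q] says that
   the multiplicative order of [i] modulo the prime [q] is [p]. *)
Definition isog_semidirect (gT : finGroupType) (G : {group gT}) (q p : nat)
    : Prop :=
  exists i : nat,
    (p.-primitive_root (i%:R : 'F_q))%R /\
    (G \isog Grp (a : b : a ^+ q, b ^+ p, b * a * b^-1 = a ^+ i))%g.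

(* Main.v *)
Require Import Defs.
From mathcomp Require Import all_boot all_order all_algebra all_fingroup all_solvable.

(** Both properties of the inclusion graph are bounds on the number [Omega #|G|]
    of prime factors of [#|G|], counted with multiplicity.

    An edge is a chain [1 < A < B < G] and a triangle is a chain
    [1 < A < B < C < G].  Since [Omega #|H|] strictly increases along a chain of
    subgroups, [Omega #|G| <= 2] forbids edges, and when [Omega #|G| <= 3]
    every edge joins a subgroup of prime order to one whose order has two
    prime factors, which is a 2-colouring.

    Conversely, if [Omega #|G|] is at least 3 (resp. 4) there must be an edge
    (resp. a triangle).  In a solvable group this is clear, because there is a
    subgroup of prime index, so that one can descend one prime factor at a
    time.  For [n <= 3] and [Omega #|G| > n] one step of this descent, from [G]
    to a proper subgroup [H] with [Omega #|H| >= n], works in every group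
    ([exists_proper_Omega]): if no [H] existed, all proper subgroups would
    have order with at most 2 prime factors, and such a group is solvable
    ([Omega_le2_solvable]).  This last fact is where group theory enters.
    Let [p] be the least prime divisor of [#|G|] and [P] a Sylow [p]-subgroup.
    If [P] is normal, induction applies to [P] and [G / P].  Otherwise the
    normaliser of [P] is a proper subgroup, so its order has at most two prime
    factors; this, with the minimality of [p], makes it centralise [P].
    Burnside's transfer argument ([Burnside_der1_proper]) then shows that [G]
    is not perfect, and induction applies to its derived subgroup.

    Hence the graph of [G] is totally disconnected iff [Omega #|G| <= 2] and
    bipartite iff [Omega #|G| <= 3].  A vertex exists only if
    [Omega #|G| >= 2], which leaves the orders [p^2] and [pq] in the first
    case; the groups of these orders are classified from a normal subgroup of
    prime index. *)

Set Implicit Arguments.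
Unset Strict Implicit.
Unset Printing Implicit Defensive.

(** * Prime factors counted with multiplicity *)

(** Summing up to [n] loses nothing: [logn p n = 0] when [p] is not prime or
    exceeds [n]. *)
Definition Omega n := \sum_(p < n.+1) logn p n.

Lemma Omega_widen n N : n < N -> \sum_(p < N) logn p n = Omega n.
Proof.
move=> ltnN; rewrite /Omega [RHS](big_ord_widen N (fun p => logn p n)) //.
rewrite [RHS]big_mkcond; apply: eq_bigr => p _; case: ltnP => // lt_n_p.
by rewrite ltn_log0.
Qed.

Lemma OmegaM m n : 0 < m -> 0 < n -> Omega (m * n) = Omega m + Omega n.
Proof.
move=> m_gt0 n_gt0; rewrite -(@Omega_widen m (m * n).+1) ?ltnS ?leq_pmulr //.
rewrite -(@Omega_widen n (m * n).+1) ?ltnS ?leq_pmull // -big_split.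
by apply: eq_bigr => p _; rewrite lognM.
Qed.

Lemma Omega1 : Omega 1 = 0.
Proof. by apply: big1 => p _; rewrite logn1. Qed.

Lemma Omega_prime p : prime p -> Omega p = 1.
Proof.
move=> p_pr; rewrite /Omega (bigD1 ord_max) //= logn_prime // eqxx big1 // => q neq.
apply/eqP; rewrite logn_prime // eqb0; apply: contraNneq neq => ?.
exact/eqP/val_inj.
Qed.

Lemma Omega_expn p k : prime p -> Omega (p ^ k) = k.
Proof.
move=> p_pr; elim: k => [|k IHk]; first exact: Omega1.
by rewrite expnS OmegaM ?expn_gt0 ?prime_gt0 // IHk Omega_prime.
Qed.

Lemma dvdn_leq_Omega m n : 0 < n -> m %| n -> Omega m <= Omega n.
Proof.
move=> n_gt0 /dvdnP[d def_n]; move: n_gt0; rewrite def_n muln_gt0.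
by case/andP=> d_gt0 m_gt0; rewrite OmegaM // leq_addl.
Qed.

Lemma Omega_divn_pdiv n : 1 < n -> Omega n = (Omega (n %/ pdiv n)).+1.
Proof.
move=> n_gt1; have p_pr := pdiv_prime n_gt1; have n_gt0 := ltnW n_gt1.
rewrite -{1}(divnK (pdiv_dvd n)) OmegaM ?pdiv_gt0 ?divn_gt0 ?pdiv_leq //.
by rewrite (Omega_prime p_pr) addn1.
Qed.

Lemma Omega_gt0 n : 1 < n -> 0 < Omega n.
Proof. by move/Omega_divn_pdiv->. Qed.

Lemma Omega_gt0P n : 0 < Omega n ->
  exists2 p, prime p & exists2 m, n = p * m & Omega n = (Omega m).+1.
Proof.
case: n => [|[|n]] => [||_]; first by rewrite /Omega big_ord1.
  by rewrite Omega1.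
exists (pdiv n.+2); first exact: pdiv_prime.
exists (n.+2 %/ pdiv n.+2); last exact: Omega_divn_pdiv.
by rewrite mulnC divnK ?pdiv_dvd.
Qed.

Lemma Omega_eq0 n : 0 < n -> Omega n = 0 -> n = 1.
Proof. by case: n => [|[|n]] // _ O0; have := @Omega_gt0 n.+2 isT; rewrite O0. Qed.

Lemma Omega_eq1 n : 0 < n -> Omega n = 1 -> prime n.
Proof.
move=> n_gt0 O1; have [p p_pr [m def_n]] := Omega_gt0P (eq_leq (esym O1)).
rewrite O1 def_n => -[/esym/Omega_eq0-> //]; first by rewrite muln1.
by move: n_gt0; rewrite def_n muln_gt0 => /andP[].
Qed.

Lemma Omega_eq2 n : 0 < n -> Omega n = 2 ->
  exists p q, [/\ prime p, prime q & n = p * q].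
Proof.
move=> n_gt0 O2; have [|p p_pr [m def_n]] := @Omega_gt0P n; first by rewrite O2.
rewrite O2 => -[/esym O1]; exists p, m; split => //; apply: Omega_eq1 => //.
by move: n_gt0; rewrite def_n muln_gt0 => /andP[].
Qed.

Lemma Omega_eq3 n : 0 < n -> Omega n = 3 ->
  exists p q r, [/\ prime p, prime q, prime r & n = p * q * r].
Proof.
move=> n_gt0 O3; have [|p p_pr [m def_n]] := @Omega_gt0P n; first by rewrite O3.
have m_gt0: 0 < m by move: n_gt0; rewrite def_n muln_gt0 => /andP[].
rewrite O3 => -[/esym/(Omega_eq2 m_gt0)[q [r [q_pr r_pr def_m]]]].
by exists p, q, r; rewrite -mulnA -def_m.
Qed.

Lemma exists_prime_notin (s : seq nat) : exists2 p, prime p & p \notin s.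
Proof.
have [p lt_s_p p_pr] := prime_above (\max_(m <- s) m); exists p => //.
apply: contraL lt_s_p => s_p; rewrite -leqNgt; exact: leq_bigmax_seq.
Qed.

Lemma extend_distinct_primes p q : prime p -> prime q -> p != q ->
  exists2 r, prime r & uniq [:: p; q; r].
Proof.
move=> p_pr q_pr neq_pq; have [r r_pr] := exists_prime_notin [:: p; q].
by exists r; rewrite // -(rot_uniq 2) /= andbC inE neq_pq.
Qed.

(** The shapes [p ^ 2] and [p ^ 3] mention one prime only, but the primes
    [q] and [r] bound with it still have to be supplied; this is why further
    primes are picked below. *)
Lemma Omega_2or3P n : 0 < n -> reflect
  (exists p q r : nat, [/\ prime p, prime q, prime r, uniq [:: p; q; r] &
       n \in [:: p ^ 2; p * q; p ^ 3; p ^ 2 * q; p * q * r]])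
  (1 < Omega n <= 3).
Proof.
move=> n_gt0; apply: (iffP idP) => [/andP[O_gt1 O_le3]|]; last first.
  case=> p [q [r [p_pr q_pr r_pr _]]].
  rewrite !inE => /or4P[|||/orP[]] /eqP->; rewrite ?expnS ?expn0 ?muln1 ?mulnA;
    by rewrite !OmegaM ?muln_gt0 ?prime_gt0 // !Omega_prime.
have two_primes p q : prime p -> prime q -> p != q ->
    n \in [:: p ^ 2; p * q; p ^ 3; p ^ 2 * q] ->
  exists p q r : nat, [/\ prime p, prime q, prime r, uniq [:: p; q; r] &
    n \in [:: p ^ 2; p * q; p ^ 3; p ^ 2 * q; p * q * r]].
- move=> p_pr q_pr neq_pq n_in.
  have [r r_pr uniq_pqr] := extend_distinct_primes p_pr q_pr neq_pq.
  exists p, q, r; split=> //; move: n_in; rewrite !inE.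
  by case/or4P=> ->; rewrite ?orbT.
have one_prime p : prime p -> n \in [:: p ^ 2; p ^ 3] ->
  exists p q r : nat, [/\ prime p, prime q, prime r, uniq [:: p; q; r] &
    n \in [:: p ^ 2; p * q; p ^ 3; p ^ 2 * q; p * q * r]].
- move=> p_pr n_in; have [q q_pr] := exists_prime_notin [:: p].
  rewrite inE eq_sym => /(two_primes p q p_pr q_pr); apply; move: n_in.
  by rewrite !inE => /orP[] ->; rewrite ?orbT.
have [O2|O3]: Omega n = 2 \/ Omega n = 3.
- by case: (Omega n) O_gt1 O_le3 => [|[|[|[|]]]] //; [left | right].
- have [p [q [p_pr q_pr def_n]]] := Omega_eq2 n_gt0 O2.
  have [eq_pq|neq_pq] := eqVneq p q.
    by apply: (one_prime p) => //; rewrite !inE def_n -eq_pq mulnn eqxx.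
  by apply: (two_primes p q) => //; rewrite !inE def_n eqxx orbT.
have [p [q [r [p_pr q_pr r_pr def_n]]]] := Omega_eq3 n_gt0 O3.
have squareful s t : prime s -> prime t -> n = s ^ 2 * t ->
  exists p q r : nat, [/\ prime p, prime q, prime r, uniq [:: p; q; r] &
    n \in [:: p ^ 2; p * q; p ^ 3; p ^ 2 * q; p * q * r]].
- move=> s_pr t_pr def_n'; have [eq_st|neq_st] := eqVneq s t.
    by apply: (one_prime s) => //; rewrite !inE def_n' -eq_st -expnSr eqxx orbT.
  by apply: (two_primes s t) => //; rewrite !inE def_n' eqxx !orbT.
have [eq_pq|neq_pq] := eqVneq p q.
  by apply: (squareful p r) => //; rewrite def_n -eq_pq mulnn.
have [eq_pr|neq_pr] := eqVneq p r.
  by apply: (squareful p q) => //; rewrite def_n -eq_pr mulnAC mulnn.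
have [eq_qr|neq_qr] := eqVneq q r.
  by apply: (squareful q p) => //; rewrite def_n -eq_qr -mulnA mulnn mulnC.
exists p, q, r; split=> //; last by rewrite !inE def_n eqxx !orbT.
by rewrite /= !inE !negb_or neq_pq neq_pr neq_qr.
Qed.

Section OmegaCard.

Variable gT : finGroupType.
Implicit Types G H : {group gT}.

Lemma OmegaLagrange G H :
  H \subset G -> Omega #|G| = Omega #|H| + Omega #|G : H|%g.
Proof. by move=> sHG; rewrite -(Lagrange sHG) OmegaM ?indexg_gt0. Qed.

Lemma subset_leq_Omega G H : H \subset G -> Omega #|H| <= Omega #|G|.
Proof. by move/OmegaLagrange->; apply: leq_addr. Qed.

Lemma Omega_card_proper G H : H \proper G -> Omega #|H| < Omega #|G|.
Proof.
move=> ltHG; rewrite (OmegaLagrange (proper_sub ltHG)) -[X in X < _]addn0 ltn_add2l.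
by rewrite Omega_gt0 // indexg_gt1 proper_subn.
Qed.

End OmegaCard.

(** * Burnside's transfer theorem *)

Section Burnside.

Local Open Scope group_scope.
Variable gT : finGroupType.
Implicit Types G P : {group gT}.

(** Both [P] and its conjugate by [g] are abelian and contain [x ^ g], hence
    are Sylow subgroups of its centraliser [C]; if [c] in [C] conjugates the
    second to the first, then [g * c] normalises [P] and acts on [x] as [g]. *)
Lemma Sylow_fusion p G P x g : p.-Sylow(G) P -> abelian P ->
    x \in P -> g \in G -> x ^ g \in P ->
  exists2 n, n \in 'N_G(P) & x ^ g = x ^ n.
Proof.
move=> sylP abP Px Gg Pxg; set y := x ^ g in Pxg *.
have sCG : 'C_G[y] \subset G := subsetIl _ _.
have sPG := pHall_sub sylP.
have sylPg : p.-Sylow(G) (P :^ g)%G by rewrite pHallJ.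
have syl1 : p.-Sylow('C_G[y]) P.
  apply: (pHall_subl _ sCG sylP); rewrite subsetI sPG sub_cent1.
  exact: subsetP abP _ Pxg.
have syl2 : p.-Sylow('C_G[y]) (P :^ g)%G.
  apply: (pHall_subl _ sCG sylPg); rewrite subsetI (pHall_sub sylPg) sub_cent1.
  by rewrite centJ memJ_conjg (subsetP abP).
have [c /setIP[Gc /cent1P cyc] defP] := Sylow_trans syl2 syl1.
exists (g * c); last by rewrite conjgM -/y conjgE -cyc mulKg.
by rewrite inE groupM //=; apply/normP; rewrite conjsgM -defP.
Qed.

(** The transfer [V] from [G] to the abelian group [P] kills the derived
    subgroup.  As fusion in [P] is trivial, the conjugates of powers of [x] in
    the expansion of [V x] are the powers themselves, so [V x] is [x] to the
    power [#|G : P|], which is prime to the order of [x]: thus [V] is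
    injective on [P]. *)
Lemma Burnside_der1_proper p G P : p.-Sylow(G) P -> P :!=: 1 ->
  'N_G(P) \subset 'C(P) -> G^`(1) \proper G.
Proof.
move=> sylP ntP cNP; have sPG := pHall_sub sylP.
have abP : abelian P by apply: subset_trans cNP; rewrite subsetI sPG normG.
have abA : abelian (idm P @* P) by rewrite morphim_idm.
have [x Px ntx] := trivgPn _ ntP.
pose V := transfer_morphism G abA.
have VG'1 : V @* G^`(1) = 1.
  by rewrite morphim_der //; apply/derG1P; apply: FinRing.zmod_abelian.
rewrite properE der_sub; apply: contra ntx => sGG'.
have Gx : x \in G := subsetP sPG x Px.
have Vx1 : V x = 1.
  by apply/set1gP; rewrite -VG'1 mem_morphim // (subsetP sGG').
have trX := transversalP (rcosets_cycle_partition sPG Gx).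
have Ax : x \in idm P @* P by rewrite morphim_idm.
have VxE : V x = (FiniteModule.fmod abA x *+ #|G : P|)%R.
  rewrite /= (transfer_cycle_expansion sPG abA Gx trX) /=.
  rewrite -(sum_index_rcosets_cycle sPG Gx trX) -GRing.sumrMnr.
  apply: eq_bigr => y Xy; rewrite /restrm /= /idm -FiniteModule.fmodX //.
  set xn := x ^+ _; have Gy : y \in G := subsetP (transversal_sub trX) y Xy.
  have Pxn : xn \in P by rewrite groupX.
  have Pxny : xn ^ y^-1 \in P.
    by rewrite conjgE invgK mulgA -mem_rcoset mulg_exp_card_rcosets.
  have [n Nn ->] := Sylow_fusion sylP abP Pxn (groupVr Gy) Pxny.
  congr FiniteModule.fmod; apply/conjg_fixP/commgP/commute_sym.
  exact: (centP (subsetP cNP n Nn)).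
rewrite Vx1 -FiniteModule.fmodX // in VxE.
have /eqP := congr1 FiniteModule.fmval VxE.
rewrite FiniteModule.fmodK ?groupX // eq_sym -order_dvdn => ox.
have /andP[_ coP] := pHall_Hall sylP.
by rewrite -order_eq1 -dvdn1 -(eqnP coP) dvdn_gcd order_dvdG.
Qed.

End Burnside.

(** * Groups whose proper subgroups have at most two prime factors *)

(** Induction on [#|G|], through a Sylow subgroup [P] for the least prime
    divisor [p] of [#|G|].  The crux is a non-normal [P], with normaliser [N]:
    either [N = P], which is abelian because its order is at most [p ^ 2], or
    [P] has order [p], and then an [N]-class in [P] has fewer than [p]
    elements while its cardinal divides [#|G|], so that it is a singleton. *)
Lemma Omega_le2_solvable (gT : finGroupType) (G : {group gT}) :
  (forall H : {group gT}, H \proper G -> Omega #|H| <= 2) -> solvable G.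
Proof.
have [n] := ubnP #|G|; elim: n gT G => [|n IHn] gT G // leGn ltG2.
have solH (H : {group gT}) : H \proper G -> solvable H.
  move=> ltHG; apply: IHn => [|K ltKH]; last exact: ltG2 (proper_trans ltKH ltHG).
  exact: leq_trans (proper_card ltHG) leGn.
have [->|ntG] := eqVneq G 1%G; first exact: solvable1.
set p := pdiv #|G|; have p_pr : prime p by rewrite pdiv_prime // cardG_gt1.
have [P sylP] := Sylow_exists p G; have [sPG pP _] := and3P sylP.
have [defP|neqPG] := eqVneq P G; first by apply: pgroup_sol (p) _ _; rewrite -defP.
have ltPG : P \proper G by rewrite properEneq neqPG.
have ntP : P :!=: 1%g.
  by rewrite -cardG_gt1 (card_Hall sylP) p_part_gt1 pi_pdiv cardG_gt1.
have [nPG|notnPG] := boolP (G \subset 'N(P)%g).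
  have nsPG : (P <| G)%g by apply/andP.
  rewrite (series_sol nsPG) solH //; apply: IHn => [|Kbar ltKbar].
    exact: leq_trans (ltn_quotient ntP sPG) leGn.
  have [K defK sPK sKG] := inv_quotientS nsPG (proper_sub ltKbar).
  have nsPK : (P <| K)%g := normalS sPK sKG nsPG.
  have ltKG : K \proper G by rewrite -(quotient_proper nsPK) // -defK.
  apply: leq_trans (ltG2 K ltKG).
  by rewrite defK card_quotient ?normal_norm // (OmegaLagrange sPK) leq_addl.
set N := ('N_G(P))%G; have ltNG : N \proper G.
  by rewrite properE subsetIl subsetI subxx.
have sPN : P \subset N by rewrite subsetI sPG normG.
have leN2 : Omega #|N| <= 2 := ltG2 N ltNG.
suffices cNP : N \subset ('C(P))%g.
  have ltG'G := Burnside_der1_proper sylP ntP cNP.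
  by rewrite (series_sol (der_normal 1 G)) solH //= abelian_sol ?der_abelian.
have oP := card_pgroup pP; set k := logn p #|P| in oP.
have [NP|/(Omega_gt0 (n := _)) indexN] : #|N : P|%g = 1 \/ 1 < #|N : P|%g.
- by case: #|_ : _|%g (indexg_gt0 N P) => [|[|m]]; [|left|right].
- have /eqP-> : N :==: P by rewrite eqEsubset sPN -indexg_eq1 NP.
  apply: (p2group_abelian pP); rewrite -/k -(Omega_expn k p_pr) -oP.
  exact: leq_trans (subset_leq_Omega sPN) leN2.
have k1 : k = 1.
  apply/eqP; rewrite eqn_leq -(Omega_expn k p_pr) -oP Omega_gt0 ?cardG_gt1 // andbT.
  by rewrite -ltnS (leq_trans _ leN2) // (OmegaLagrange sPN) -addn1 leq_add2l.
rewrite {}k1 expn1 in oP.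
have /cyclicP[x defP] : cyclic P by rewrite prime_cyclic ?oP.
rewrite defP cent_cycle; suffices: #|N : 'C_N[x]|%g <= 1.
  by rewrite leqNgt indexg_gt1 negbK subsetI subxx.
have ntx : x != 1%g by rewrite -cycle_eq1 -defP.
have dvdG : #|N : 'C_N[x]|%g %| #|G|.
  exact: dvdn_trans (dvdn_indexg _ _) (cardSg (subsetIl _ _)).
rewrite leqNgt; apply/negP=> /pdiv_min_dvd/(_ dvdG).
rewrite -/p leqNgt -oP index_cent1 => /negP[].
suffices: (x ^: N \subset P^#)%g.
  by move/subset_leq_card/leq_ltn_trans; apply; rewrite [X in _ < X](cardsD1 1%g) group1.
rewrite class_sub_norm; first by rewrite !inE ntx defP cycle_id.
by rewrite normD1 subsetIr.
Qed.

(** The bound 3 is the reach of [Omega_le2_solvable]: a counterexample has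
    only proper subgroups with fewer than [n], hence at most 2, prime factors,
    so it is solvable and has a subgroup of prime index. *)
Lemma exists_proper_Omega (gT : finGroupType) (G : {group gT}) n :
    n <= 3 -> n < Omega #|G| ->
  exists2 H : {group gT}, H \proper G & n <= Omega #|H|.
Proof.
move=> n_le3 ltnG.
have [/existsP[H /andP[]]|] :=
  boolP [exists H : {group gT}, (H \proper G) && (n <= Omega #|H|)].
  by exists H.
rewrite negb_exists => /forallP noH.
have ltn (H : {group gT}) : H \proper G -> Omega #|H| < n.
  by move=> ltHG; have := noH H; rewrite ltHG -ltnNge.
have solG : solvable G.
  by apply: Omega_le2_solvable => H /ltn ltHn; rewrite -ltnS (leq_trans ltHn).
have ntG : G :!=: 1%g.
  by apply: contraTneq ltnG => ->; rewrite cards1 Omega1.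
have [H /andP[sHG _] prGH] := sol_prime_factor_exists solG ntG.
exists H; last by move: ltnG; rewrite (OmegaLagrange sHG) (Omega_prime prGH) addn1.
by rewrite properE sHG -indexg_gt1 prime_gt1.
Qed.

(** * The inclusion graph and the number of prime factors *)

Section InclusionGraphOmega.

Variable gT : finGroupType.
Implicit Types G H : {group gT}.

Lemma proper_nontrivialE G H :
  proper_nontrivial G H = (H \proper G) && (0 < Omega #|H|).
Proof.
rewrite /proper_nontrivial andbCA andbC; congr (_ && _).
  by rewrite properEneq andbC.
rewrite -cardG_gt1; apply/idP/idP; first exact: Omega_gt0.
apply: contraTT; rewrite -leqNgt.
by case: #|H| (cardG_gt0 H) => [|[|]]; rewrite ?Omega1.
Qed.

Lemma incl_adjE G (x y : inclusion_graph G) :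
  adj x y = (val x \proper val y) || (val y \proper val x).
Proof.
rewrite /= /incl_adj; have [->|neq_xy] := eqVneq x y; first by rewrite !properxx.
have neq_vals : val x != val y :> {set gT}.
  by apply: contraNneq neq_xy => /group_inj/val_inj->.
by rewrite !properEneq neq_vals eq_sym neq_vals.
Qed.

Lemma inclusion_graph_vertex G H :
  H \proper G -> 0 < Omega #|H| -> exists x : inclusion_graph G, val x = H.
Proof.
move=> ltHG ntH.
have HP : proper_nontrivial G H by rewrite proper_nontrivialE ltHG.
by exists (Sub H HP); rewrite SubK.
Qed.

Lemma inclusion_graph_nonempty G : 0 < #|inclusion_graph G| -> 1 < Omega #|G|.
Proof.
case/card_gt0P=> x _; have := valP x; rewrite proper_nontrivialE => /andP[ltHG ntH].
exact: leq_ltn_trans ntH (Omega_card_proper ltHG).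
Qed.

Lemma totally_disconnected_inclusionP G :
  totally_disconnected (inclusion_graph G) <-> Omega #|G| <= 2.
Proof.
split=> [noadj | leG2 x y].
  rewrite leqNgt; apply/negP=> ltG.
  have [B ltBG ltB] := exists_proper_Omega (n := 2) isT ltG.
  have [A ltAB ltA] := exists_proper_Omega (n := 1) isT ltB.
  have [x def_x] := inclusion_graph_vertex (proper_trans ltAB ltBG) ltA.
  have [y def_y] := inclusion_graph_vertex ltBG (ltnW ltB).
  by have := noadj x y; rewrite incl_adjE def_x def_y ltAB.
rewrite incl_adjE; have := valP x; have := valP y; rewrite !proper_nontrivialE.
move=> /andP[/Omega_card_proper ltyG nty] /andP[/Omega_card_proper ltxG ntx].
have nolt (u v : {group gT}) :
  0 < Omega #|u| -> Omega #|v| < Omega #|G| -> ~~ (u \proper v).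
- move=> ntu ltvG; apply/negP=> /Omega_card_proper ltuv.
  by have := leq_ltn_trans (leq_ltn_trans ntu ltuv) ltvG; rewrite ltnNge leG2.
by rewrite negb_or !nolt.
Qed.

Lemma bipartite_inclusionP G :
  bipartite (inclusion_graph G) <-> Omega #|G| <= 3.
Proof.
split=> [[X [Y [_ XY0 XYadj]]] | leG3].
  rewrite leqNgt; apply/negP=> ltG.
  have [C ltCG ltC] := exists_proper_Omega (n := 3) isT ltG.
  have [B ltBC ltB] := exists_proper_Omega (n := 2) isT ltC.
  have [A ltAB ltA] := exists_proper_Omega (n := 1) isT ltB.
  have ltBG := proper_trans ltBC ltCG.
  have [x def_x] := inclusion_graph_vertex (proper_trans ltAB ltBG) ltA.
  have [y def_y] := inclusion_graph_vertex ltBG (ltnW ltB).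
  have [z def_z] := inclusion_graph_vertex ltCG (ltnW (ltnW ltC)).
  have disj u : (u \in X) && (u \in Y) = false by rewrite -in_setI XY0 inE.
  have xy : adj x y by rewrite incl_adjE def_x def_y ltAB.
  have yz : adj y z by rewrite incl_adjE def_y def_z ltBC.
  have xz : adj x z by rewrite incl_adjE def_x def_z (proper_trans ltAB ltBC).
  (* No 2-colouring of the triangle x, y, z is proper. *)
  move: (XYadj _ _ xy) (XYadj _ _ yz) (XYadj _ _ xz) (disj x) (disj y) (disj z).
  by do 6!case: (_ \in _).
pose X := [set x : inclusion_graph G | Omega #|val x| == 1].
exists X, (~: X); split=> [||x y]; [exact: setUCr | exact: setICr |].
wlog ltxy : x y / val x \proper val y => [IH|_].
  rewrite incl_adjE => /orP[] lt; first by apply: IH => //; rewrite incl_adjE lt.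
  by rewrite orbC andbC [X in _ || X]andbC; apply: IH => //; rewrite incl_adjE lt.
have := valP x; have := valP y; rewrite !proper_nontrivialE.
move=> /andP[/Omega_card_proper ltyG _] /andP[_ ntx].
have ltOxy := Omega_card_proper ltxy; apply/orP; left; rewrite !inE.
case: (Omega #|val x|) ntx ltOxy => [|[|m]] // _; last first.
  move=> ltmy; have := leq_ltn_trans ltmy ltyG; rewrite ltnNge => /negP[].
  exact: leq_trans leG3 _.
by move=> lt1y; rewrite eqxx gtn_eqF.
Qed.

End InclusionGraphOmega.

(** * Groups whose order has two prime factors *)

Section TwoPrimeFactors.

Local Open Scope group_scope.

Lemma card_Zn n : 1 < n -> #|[set: 'Z_n]| = n.
Proof. by move=> n_gt1; rewrite cardsT card_ord Zp_cast. Qed.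

Lemma isog_Zn (gT : finGroupType) (G : {group gT}) n :
  cyclic G -> #|G| = n -> 1 < n -> G \isog [set: 'Z_n].
Proof.
move=> cycG oG n_gt1; rewrite isog_cyclic_card // card_Zn // oG eqxx andbT.
by apply/cyclicP; exists Zp1; apply: Zp_cycle.
Qed.

Lemma abelem_ZpxZp p : prime p -> p.-abelem [set: 'Z_p * 'Z_p].
Proof.
move=> p_pr; apply/abelemP => //; split.
  apply/centsP => -[x1 x2] _ [y1 y2] _; rewrite /commute.
  by congr (_, _); apply: Zp_mulgC.
have expp (x : 'Z_p) : x ^+ p = 1.
  by have := expg_cardG (in_setT x); rewrite card_Zn // prime_gt1.
move=> [x1 x2] _; have expE n : (x1, x2) ^+ n = (x1 ^+ n, x2 ^+ n).
  by elim: n => // n IHn; rewrite !expgS IHn.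
by rewrite expE !expp.
Qed.

(** If [G] is not cyclic then no element has order [p ^ 2], so [G] is
    elementary abelian. *)
Lemma isog_card_p2 (gT : finGroupType) (G : {group gT}) p :
    prime p -> #|G| = (p ^ 2)%N ->
  G \isog [set: 'Z_(p ^ 2)] \/ G \isog [set: 'Z_p * 'Z_p].
Proof.
move=> p_pr oG; have p_gt1 := prime_gt1 p_pr; have [cycG|ncycG] := boolP (cyclic G).
  by left; apply: isog_Zn => //; rewrite -(exp1n 2) ltn_exp2r.
right; have abG : p.-abelem G.
  apply/abelemP => //; split=> [|x Gx]; first exact: card_p2group_abelian oG.
  have := order_dvdG Gx; rewrite oG => /(dvdn_pfactor _ _ p_pr)[k le_k2 ox].
  apply/eqP; rewrite -order_dvdn ox; case: k le_k2 ox => [|[|[|]]] // _ ox.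
  case/negP: ncycG; apply/cyclicP; exists x; apply/eqP.
  by rewrite eq_sym eqEcard cycle_subG Gx oG -orderE ox leqnn.
rewrite (isog_abelem_card _ abG) abelem_ZpxZp //= cardsT card_prod -!cardsT.
by rewrite card_Zn // oG mulnn.
Qed.

Lemma conj_expg_iter (gT : finGroupType) (a c : gT) i j :
  a ^ c = a ^+ i -> a ^ (c ^+ j) = a ^+ (i ^ j).
Proof.
move=> ac; elim: j => [|j IHj]; first by rewrite conjg1.
by rewrite expgSr conjgM IHj conjXg ac -expgM -expnS.
Qed.

(** Conjugation is [x ^ y = y^-1 * x * y], so the relator of the presentation
    is conjugation by [b^-1]. *)
Lemma conjVgE (gT : finGroupType) (a b : gT) : b * a * b^-1 = a ^ b^-1.
Proof. by rewrite conjgE invgK mulgA. Qed.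

(** Given a group generated by [x] and [y] satisfying the relations, the maps
    sending [a] to [x] and [b] to [y] are compatible with the two conjugation
    actions, hence glue to a morphism on the semidirect product. *)
Lemma sdprod_isoGrp (gT : finGroupType) (G : {group gT}) (a b : gT) q p i :
  #[a] = q -> #[b] = p -> <[a]> ><| <[b]> = G -> b * a * b^-1 = a ^+ i ->
  G \isog Grp (a : b : a ^+ q, b ^+ p, b * a * b^-1 = a ^+ i).
Proof.
move=> oa ob defG ab; have [_ defGm nab _] := sdprodP defG.
apply: intro_isoGrp => [|rT H].
  apply/existsP; exists (a, b); rewrite /= !xpair_eqE ab eqxx.
  by rewrite norm_joinEr // defGm eqxx -oa -ob !expg_order !eqxx.
case/existsP=> -[x y] /= /eqP[defH xq yp xy].
have fxP : #[x] %| #[a] by rewrite order_dvdn oa xq.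
have fyP : #[y] %| #[b] by rewrite order_dvdn ob yp.
rewrite conjVgE in ab; rewrite conjVgE in xy.
have fP : {in <[a]> & <[b]>, morph_act 'J 'J (eltm fxP) (eltm fyP)}.
  (* Elements of <[b]> are written as powers of b^-1, the conjugation by which
     is given by the relator. *)
  move=> _ bj /cycleP[m ->]; rewrite -cycleV => /cycleP[j ->] /=.
  have -> : eltm fyP (b^-1 ^+ j) = y^-1 ^+ j.
    by rewrite morphX ?groupV ?cycle_id // morphV ?cycle_id //= eltm_id.
  rewrite conjXg (conj_expg_iter j ab) eltmE conjXg (conj_expg_iter j xy).
  by rewrite -expgM eltmE expgM.
apply/homgP; exists (sdprodm_morphism defG fP).
rewrite im_sdprodm !morphim_cycle ?cycle_id //= !eltm_id -norm_joinEr //.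
by rewrite cycle_subG -groupV -cycle_subG norms_cycle xy mem_cycle.
Qed.

Lemma isoGrp_card_dvdn (gT : finGroupType) (G : {group gT}) q p i :
  G \isog Grp (a : b : a ^+ q, b ^+ p, b * a * b^-1 = a ^+ i) -> #|G| %| q * p.
Proof.
move/isoGrp_hom/existsP=> [[x y]] /= /eqP[<- xq yp xy].
rewrite conjVgE in xy.
have nxy : <[y]> \subset 'N(<[x]>).
  by rewrite cycle_subG -groupV -cycle_subG norms_cycle xy mem_cycle.
rewrite norm_joinEr //; apply: (@dvdn_trans (#[x] * #[y])%N).
  by rewrite !orderE mul_cardG dvdn_mulr.
by rewrite dvdn_mul // order_dvdn ?xq ?yp.
Qed.

(** Conjugating [p] times by [b^-1] raises [a] to the power [i ^ p] and fixes
    it, so [i ^ p] is 1 modulo [q]; and [i] is not, as [b] moves [a]. *)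
Lemma primitive_conj (gT : finGroupType) (a b : gT) q p i :
    prime q -> prime p -> #[a] = q -> #[b] = p ->
    a ^ b^-1 = a ^+ i -> a ^ b != a ->
  (p.-primitive_root (i%:R : 'F_q))%R.
Proof.
move=> q_pr p_pr oa ob ab nab.
have natq m n : a ^+ m = a ^+ n -> (m%:R = n%:R :> 'F_q)%R.
  move/eqP; rewrite eq_expg_mod_order oa => /eqP eqmn.
  by rewrite -(Fp_nat_mod q_pr m) eqmn Fp_nat_mod.
have ip1 : ((i%:R : 'F_q) ^+ p = 1)%R.
  rewrite -GRing.natrX; apply: (natq _ 1%N); rewrite -(conj_expg_iter p ab).
  by rewrite expgVn -ob expg_order invg1 conjg1.
have [m prim_m] := prim_order_exists (prime_gt0 p_pr) ip1.
move/(proj2 (primeP p_pr)) => /pred2P[m1 | eq_mp]; last by rewrite -eq_mp.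
case/eqP: nab; have := prim_expr_order prim_m; rewrite m1 GRing.expr1.
move/(congr1 val); rewrite /= (val_Fp_nat q_pr) => i1.
have/conjg_fixP/commgP/commuteV : a ^ b^-1 = a.
  apply/eqP; rewrite ab -[X in _ == X]expg1 eq_expg_mod_order oa i1.
  by rewrite pdiv_id // Zp_cast // prime_gt1.
by rewrite invgK => /commgP/conjg_fixP.
Qed.

(** Such a [G] is solvable, so it has a normal subgroup [<[a]>] of prime index
    [p] and prime order [q].  When [p] and [q] differ, an element [b] of order
    [p] generates a complement, and [G] is cyclic or one of the semidirect
    products according to whether [b] centralises [a]. *)
Lemma Omega_eq2_classification (gT : finGroupType) (G : {group gT}) :
    Omega #|G| = 2 ->
  exists p q : nat, [/\ prime p, prime q, p != q &
       [\/ G \isog [set: 'Z_(p ^ 2)],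
           G \isog [set: 'Z_p * 'Z_p],
           G \isog [set: 'Z_(p * q)] |
           isog_semidirect G q p]].
Proof.
move=> OG; have ntG : G :!=: 1.
  by apply/eqP=> G1; rewrite G1 cards1 Omega1 in OG.
have solG : solvable G.
  by apply: Omega_le2_solvable => H /Omega_card_proper; rewrite OG; apply: ltnW.
have [H nsHG p_pr] := sol_prime_factor_exists solG ntG.
have sHG := normal_sub nsHG; set p := #|G : H| in p_pr.
have q_pr : prime #|H|.
  apply: Omega_eq1 => //.
  by move: OG; rewrite (OmegaLagrange sHG) (Omega_prime p_pr) addn1 => -[].
have := Lagrange sHG; rewrite -/p; set q := #|H| => oG.
have [eq_qp | neq_qp] := eqVneq q p.
  have [r r_pr] := exists_prime_notin [:: p]; rewrite inE => neq_rp.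
  exists p, r; split=> //; first by rewrite eq_sym.
  rewrite eq_qp mulnn in oG.
  by have [] := isog_card_p2 p_pr (esym oG); [constructor 1 | constructor 2].
exists p, q; split=> //; first by rewrite eq_sym.
have /cyclicP[a defH] : cyclic H := prime_cyclic q_pr.
have oa : #[a] = q by rewrite orderE -defH.
have [b Gb ob] := Cauchy p_pr (dvdn_indexg G H).
have co_ab : coprime #[a] #[b] by rewrite oa ob prime_coprime // dvdn_prime2.
have nab : <[b]> \subset 'N(<[a]>).
  by rewrite -defH (subset_trans _ (normal_norm nsHG)) // cycle_subG.
have tiab : <[a]> :&: <[b]> = 1 by apply: coprime_TIg.
have defG : <[a]> * <[b]> = G.
  apply/eqP; rewrite eqEcard mul_subG ?cycle_subG //=; last first.
    by rewrite -cycle_subG -defH.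
  by rewrite TI_cardMg // -!orderE oa ob oG.
have [fix_ab | nfix_ab] := eqVneq (a ^ b) a.
  constructor 3; apply: isog_Zn; last 1 first.
  - by rewrite -(muln1 1%N) ltn_mul ?prime_gt1.
  - rewrite -defG; apply: cyclicM; rewrite ?cycle_cyclic -?orderE //.
    rewrite cent_cycle cycle_subG; apply/cent1P/commute_sym/commgP.
    exact/conjg_fixP.
  by rewrite -oG mulnC.
constructor 4.
have /cycleP[i ab] : a ^ b^-1 \in <[a]>.
  by rewrite memJ_norm ?cycle_id // groupV -cycle_subG.
exists i; split; first exact: primitive_conj ob ab nfix_ab.
by apply: (sdprod_isoGrp oa ob); [rewrite sdprodE | rewrite conjVgE].
Qed.

Lemma classification_Omega_le2 (gT : finGroupType) (G : {group gT}) p q :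
    prime p -> prime q ->
    [\/ G \isog [set: 'Z_(p ^ 2)],
        G \isog [set: 'Z_p * 'Z_p],
        G \isog [set: 'Z_(p * q)] |
        isog_semidirect G q p] ->
  Omega #|G| <= 2.
Proof.
move=> p_pr q_pr.
have Opq : Omega (p * q) = 2 by rewrite OmegaM ?prime_gt0 // !Omega_prime.
case=> [isoG | isoG | isoG | [i [_ isoG]]].
- rewrite (card_isog isoG) card_Zn ?Omega_expn //.
  by rewrite -(exp1n 2) ltn_exp2r // prime_gt1.
- rewrite (card_isog isoG) cardsT card_prod -!cardsT card_Zn ?prime_gt1 //.
  by rewrite mulnn Omega_expn.
- rewrite (card_isog isoG) card_Zn ?Opq //.
  by rewrite -(muln1 1%N) ltn_mul ?prime_gt1.
rewrite -Opq mulnC; apply: dvdn_leq_Omega (isoGrp_card_dvdn isoG).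
by rewrite muln_gt0 !prime_gt0.
Qed.

End TwoPrimeFactors.

(** * Totally disconnected and bipartite inclusion graphs *)

Theorem corollary2p2 (gT : finGroupType) (G : {group gT})
    (nonempty : 0 < #|inclusion_graph G|) :
  (totally_disconnected (inclusion_graph G) <->
     exists p q : nat, [/\ prime p, prime q, p != q &
       [\/ G \isog [set: 'Z_(p ^ 2)],
           G \isog [set: 'Z_p * 'Z_p],
           G \isog [set: 'Z_(p * q)] |
           isog_semidirect G q p]]) /\
  (bipartite (inclusion_graph G) <->
     exists p q r : nat, [/\ prime p, prime q, prime r, uniq [:: p; q; r] &
       #|G| \in [:: p ^ 2; p * q; p ^ 3; p ^ 2 * q; p * q * r]]).
Proof.
have G_gt1 := inclusion_graph_nonempty nonempty; split.
  apply: iff_trans (totally_disconnected_inclusionP G) _.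
  split=> [G_le2 | [p [q [p_pr q_pr _]]]]; last exact: classification_Omega_le2.
  by apply: Omega_eq2_classification; apply/eqP; rewrite eqn_leq G_le2.
apply: iff_trans (bipartite_inclusionP G) _.
have/rwP GP := Omega_2or3P (cardG_gt0 G).
by split=> [G_le3 | /GP/andP[] //]; apply/GP; rewrite G_gt1.
Qed.
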